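(* Let $S\subset\mathbb{R}^d$ be nonempty and closed, let $\epsilon\geq 0$, let $F$ be a nonempty, closed, and bounded subset of $(\mathrm{usc\text{-}fcns}(S),\mathbf{d})$, and let $(S^0,\mathcal{B}^0,P^0)$ be a complete probability space with $S^0\subset\mathbb{R}^{d_0}$. If $\psi:S^0\times F\to[-\infty,\infty]$ is a locally inf-integrable random lsc function and $\pi:F\to(-\infty,\infty]$ is lsc, then $$\epsilon\text{-}\operatorname{argmin}_{f\in F}\ \int\psi(x,f)\,dP^0(x)+\pi(f)\neq\emptyset\quad\text{and}\quad \inf_{f\in F}\ \int\psi(x,f)\,dP^0(x)+\pi(f)>-\infty .$$
   Context: Notation: $\overline{\mathbb{R}}=[-\infty,\infty]$. $\mathrm{usc\text{-}fcns}(S)$ is the set of upper semicontinuous (usc) functions $f:S\to\overline{\mathbb{R}}$ with $f\not\equiv-\infty$. The hypograph is $\operatorname{hypo} f=\{(x,\alpha)\in S\times\mathbb{R}\mid f(x)\geq\alpha\}$. Fix any norm on $\mathbb{R}^d\times\mathbb{R}$ and a point $z^{\rm ctr}\in S\times\mathbb{R}$. The Attouch-Wets (aw) distance is $\mathbf{d}(f,g)=\int_0^\infty \mathbf{d}_\rho(f,g)e^{-\rho}d\rho$, where $\mathbf{d}_\rho(f,g)=\max\{|\operatorname{dist}(z,\operatorname{hypo} f)-\operatorname{dist}(z,\operatorname{hypo} g)| : \|z-z^{\rm ctr}\|\leq\rho\}$ and $\operatorname{dist}$ is the point-to-set distance. Convergence $f^n\to f$ in $\mathrm{usc\text{-}fcns}(S)$,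 closedness, boundedness, etc. are with respect to $\mathbf{d}$. Convergence $\mathbf{d}(f^n,f)\to0$ is equivalent to hypo-convergence: $\limsup f^n(x^n)\leq f(x)$ for all $x^n\in S\to x$, and for every $x\in S$ there is $x^n\in S\to x$ with $\liminf f^n(x^n)\geq f(x)$. A function $\phi:F\to\overline{\mathbb{R}}$ is lsc if $\liminf\phi(f^n)\geq\phi(f)$ whenever $f^n\in F\to f\in F$. For $\epsilon\ge 0$, $\epsilon\text{-}\operatorname{argmin}_{f\in F}\phi(f)=\{f\in F\mid \phi(f)\leq\inf_{g\in F}\phi(g)+\epsilon\}$. Extended arithmetic: $0\cdot\infty=0$, $\alpha\cdot\infty=\infty$ for $\alpha>0$, $\alpha+\infty=\infty$ for $\alpha\in\overline{\mathbb{R}}$, $\alpha-\infty=-\infty$ for $\alpha\in[-\infty,\infty)$; in particular $\infty-\infty=\infty$, so that the integral of any measurable extended real-valued function is well defined. For $F$ closed and a complete probability space $(S^0,\mathcal{B}^0,P^0)$, $\psi:S^0\times F\to\overline{\mathbb{R}}$ is a random lsc function if $\psi(x,\cdot)$ is lsc for all $x\in S^0$ and $\psi$ is measurable with respect to the product sigma-algebra on $S^0\times F$ (with the Borel sigma-algebra under $\mathbf{d}$ on $F$). It is locally inf-integrable if for all $f\in F$ there exists $\rho>0$ such that $\int\inf_{g\in F}\{\psi(x,g)\mid\mathbf{d}(f,g)\leq\rho\}\,dP^0(x)>-\infty$. *)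

(* Defs.v *)
From HB Require Import structures.
From mathcomp Require Import all_boot all_order all_algebra.
From mathcomp Require Import all_classical all_reals all_analysis.
From mathcomp Require Import measurable_realfun.

Set Implicit Arguments.
Unset Strict Implicit.
Unset Printing Implicit Defensive.

Import Order.TTheory GRing.Theory Num.Theory.
Import numFieldNormedType.Exports.
Local Open Scope classical_set_scope.
Local Open Scope ring_scope.

Section Norms.
Context {R : realType} (V : lmodType R).

(* An arbitrary norm on V, independent of any norm V may canonically carry. *)
Record norm_on := NormOn {
  norm_fun :> V -> R;
  norm_triangle : forall u v, norm_fun (u + v) <= norm_fun u + norm_fun v;
  norm_homogeneous : forall a v, norm_fun (a *: v) = `|a| * norm_fun v;
  norm_definite : forall v, norm_fun v = 0 -> v = 0 }.

Definition set_dist (N : norm_on) (z : V) (A : set V) : R :=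
  inf [set N (z - w) | w in A].

Lemma norm0 (N : norm_on) : N 0 = 0.
Proof. by rewrite -(scale0r 0) norm_homogeneous normr0 mul0r. Qed.

End Norms.

Section UscFunctions.
Context {R : realType} {d : nat} (S : set 'rV[R]_d).

Record usc_fcns := UscFcns {
  usc_val :> S -> \bar R;
  usc_valP : lower_semicontinuous (\- usc_val)%E;
  usc_neqNy : exists x, usc_val x != -oo%E }.

Definition hypo (f : usc_fcns) : set ('rV[R]_d * R) :=
  [set p | exists2 x : S, \val x = p.1 & (p.2%:E <= f x)%E].

End UscFunctions.

Section AttouchWets.
Context {R : realType} {d : nat} {S : set 'rV[R]_d}.
Variables (N : norm_on ('rV[R]_d * R)%type) (zctr : S * R).
Implicit Types (f g h : usc_fcns S) (rho : R).

Let ctr : 'rV[R]_d * R := (\val zctr.1, zctr.2).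

Definition aw_dist_rho rho f g : \bar R :=
  ereal_sup [set `|set_dist N z (hypo f) - set_dist N z (hypo g)|%:E
            | z in [set z | N (z - ctr) <= rho]].

(* Extended real-valued for convenience; the integrand grows at most like
   (1 + rho) * expR (- rho), so the value is always finite. *)
Definition aw_dist f g : \bar R :=
  (\int[lebesgue_measure]_(rho in `[0%R, +oo[%classic)
     (aw_dist_rho rho f g * (expR (- rho))%:E))%E.

Let weighted f g rho : \bar R := (aw_dist_rho rho f g * (expR (- rho))%:E)%E.

Lemma aw_dist_rho_ge0 rho f g : 0 <= rho -> (0 <= aw_dist_rho rho f g)%E.
Proof.
move=> rho0; apply: (@le_trans _ _
  `|set_dist N ctr (hypo f) - set_dist N ctr (hypo g)|%:E); first by rewrite lee_fin.
by apply: ereal_sup_ubound; exists ctr => //=; rewrite subrr norm0.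
Qed.

Lemma aw_dist_rhoC rho f g : aw_dist_rho rho f g = aw_dist_rho rho g f.
Proof.
by congr ereal_sup; apply/seteqP; split => _ [z /= zr <-]; exists z => //;
  rewrite distrC.
Qed.

Lemma aw_dist_rhoxx rho f : 0 <= rho -> aw_dist_rho rho f f = 0%E.
Proof.
move=> rho0; apply/eqP; rewrite eq_le aw_dist_rho_ge0// andbT.
by apply: ge_ereal_sup => _ [z _ <-]; rewrite subrr normr0.
Qed.

Lemma aw_dist_rho_triangle rho f g h :
  (aw_dist_rho rho f h <= aw_dist_rho rho f g + aw_dist_rho rho g h)%E.
Proof.
apply: ge_ereal_sup => _ [z /= zr <-].
apply: (@le_trans _ _ (`|set_dist N z (hypo f) - set_dist N z (hypo g)|%:E
  + `|set_dist N z (hypo g) - set_dist N z (hypo h)|%:E)%E).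
  by rewrite -EFinD lee_fin ler_distD.
by apply: leeD; apply: ereal_sup_ubound; exists z.
Qed.

Lemma aw_dist_rho_homo f g :
  {homo (fun rho => aw_dist_rho rho f g) : x y / x <= y >-> (x <= y)%E}.
Proof.
move=> x y xy; apply: ereal_sup_le => _ [z /= zx <-].
by exists z => //=; exact: le_trans xy.
Qed.

Lemma measurable_aw_dist_rho f g :
  measurable_fun setT (fun rho : R => aw_dist_rho rho f g).
Proof.
apply: (measurability (@ErealGenOInfty.G R)) => [|/= _ [_] [r] -> <-].
  exact: ErealGenOInfty.measurableE.
apply: measurableI => //; apply: is_interval_measurable => s t/=.
rewrite !in_itv/= !andbT => fs ft u /andP[su ut].
by rewrite in_itv/= andbT (lt_le_trans fs)//; exact: aw_dist_rho_homo.
Qed.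

Let measurable_weighted f g :
  measurable_fun (`[0, +oo[%classic : set R) (weighted f g).
Proof.
apply: measurable_funTS; apply: emeasurable_funM.
  exact: measurable_aw_dist_rho.
apply/measurable_EFinP; exact: measurableT_comp.
Qed.

Let weighted_ge0 f g rho : (`[0, +oo[%classic : set R) rho -> (0 <= weighted f g rho)%E.
Proof.
rewrite /= in_itv/= andbT => rho0.
by rewrite mule_ge0 ?aw_dist_rho_ge0// lee_fin expR_ge0.
Qed.

Lemma aw_dist_ge0 f g : (0 <= aw_dist f g)%E.
Proof. by apply: integral_ge0 => rho; exact: weighted_ge0. Qed.

Lemma aw_distxx f : aw_dist f f = 0%E.
Proof.
apply: integral0_eq => rho; rewrite /= in_itv/= andbT => rho0.
by rewrite aw_dist_rhoxx// mul0e.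
Qed.

Lemma aw_distC f g : aw_dist f g = aw_dist g f.
Proof. by apply: eq_integral => rho _; rewrite aw_dist_rhoC. Qed.

Lemma aw_dist_triangle f g h :
  (aw_dist f h <= aw_dist f g + aw_dist g h)%E.
Proof.
rewrite /aw_dist -ge0_integralD//; last 4 first.
  exact: weighted_ge0.
  exact: measurable_weighted.
  exact: weighted_ge0.
  exact: measurable_weighted.
apply: ge0_le_integral => //.
- exact: weighted_ge0.
- exact: measurable_weighted.
- by apply: emeasurable_funD; exact: measurable_weighted.
move=> rho; rewrite /= in_itv/= andbT => rho0.
rewrite -ge0_muleDl ?aw_dist_rho_ge0//.
by rewrite lee_wpmul2r ?lee_fin ?expR_ge0// aw_dist_rho_triangle.
Qed.

End AttouchWets.

(* An alias whose arguments select the aw-distance that gives the topology. *)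
Definition aw_space {R : realType} {d : nat} {S : set 'rV[R]_d}
  (N : norm_on ('rV[R]_d * R)%type) (zctr : S * R) : Type := usc_fcns S.

Section AwSpace.
Context {R : realType} {d : nat} {S : set 'rV[R]_d}.
Variables (N : norm_on ('rV[R]_d * R)%type) (zctr : S * R).
Local Notation aw_space := (aw_space N zctr).
Local Notation aw_dist := (aw_dist N zctr).

HB.instance Definition _ := gen_eqMixin aw_space.
HB.instance Definition _ := gen_choiceMixin aw_space.

Let cst0_usc : lower_semicontinuous (\- (cst 0 : S -> \bar R))%E.
Proof. by move=> x a ax; exists setT => //; exact: filterT. Qed.

Let cst0_neqNy : exists x : S, (cst 0 x : \bar R) != -oo%E.
Proof. by exists zctr.1. Qed.

HB.instance Definition _ :=
  isPointed.Build aw_space (UscFcns cst0_usc cst0_neqNy).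

Let aw_ball (f : aw_space) (e : R) : set aw_space :=
  [set g | (aw_dist f g < e%:E)%E].

Let aw_ball_center f e : 0 < e -> aw_ball f e f.
Proof. by move=> e0; rewrite /aw_ball/= aw_distxx lte_fin. Qed.

Let aw_ball_sym f g e : aw_ball f e g -> aw_ball g e f.
Proof. by rewrite /aw_ball/= aw_distC. Qed.

Let aw_ball_triangle f g h e1 e2 :
  aw_ball f e1 g -> aw_ball g e2 h -> aw_ball f (e1 + e2) h.
Proof.
rewrite /aw_ball/= => fg gh; apply: le_lt_trans (aw_dist_triangle N zctr f g h) _.
by rewrite EFinD lteD.
Qed.

Let aw_ent : set_system (aw_space * aw_space) := entourage_ aw_ball.

HB.instance Definition _ := hasNbhs.Build aw_space (nbhs_ aw_ent).
HB.instance Definition _ := @Nbhs_isPseudoMetric.Build R aw_space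
  aw_ent erefl aw_ball aw_ball_center aw_ball_sym aw_ball_triangle erefl.

Lemma aw_ballE (f : aw_space) (e : R) :
  ball f e = [set g : aw_space | (aw_dist f g < e%:E)%E].
Proof. by []. Qed.

Definition aw_bounded (F : set aw_space) : Prop :=
  exists M : R, forall f g, F f -> F g -> (aw_dist f g <= M%:E)%E.

End AwSpace.

Definition lsc_on {R : realType} {X : topologicalType} (F : set X)
    (phi : X -> \bar R) : Prop :=
  forall (u : nat -> X) (f : X), (forall n, F (u n)) -> F f ->
    u @ \oo --> f -> (phi f <= limn_einf (phi \o u))%E.

Definition eps_argmin {R : realType} {X : Type} (F : set X)
    (phi : X -> \bar R) (eps : R) : set X :=
  [set f | F f /\ (phi f <= ereal_inf [set phi g | g in F] + eps%:E)%E].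

Section RandomLsc.
Context {R : realType} {disp : measure_display} {T : measurableType disp}.

(* The library's integral takes +oo - +oo = -oo; the dual subtraction of the
   positive and negative parts takes +oo - +oo = +oo instead. *)
Definition integral_pinfty (P : set T -> \bar R) (h : T -> \bar R) : \bar R :=
  ((\int[P]_x (h^\+ x))%E - (\int[P]_x (h^\- x))%E)%dE.

Context {d : nat} {S : set 'rV[R]_d}.
Context {N : norm_on ('rV[R]_d * R)%type} {zctr : S * R}.
Let X := aw_space N zctr.

Definition aw_borel : Type := g_sigma_algebraType (@open X).
HB.instance Definition _ := Measurable.on aw_borel.

(* Only the values of psi on T * F matter.  For F closed, the measurable
   subsets of setT `*` F are the product sigma-algebra of T and of the Borel
   sets of F. *)
Definition random_lsc (F : set X) (psi : T -> X -> \bar R) : Prop :=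
  (forall x, lsc_on F (psi x)) /\
  measurable_fun (setT `*` (F : set aw_borel))
    (fun xf : T * aw_borel => psi xf.1 xf.2).

Definition locally_inf_integrable (P : set T -> \bar R) (F : set X)
    (psi : T -> X -> \bar R) : Prop :=
  forall f, F f -> exists2 rho : R, 0 < rho &
    (-oo < integral_pinfty P (fun x =>
      ereal_inf [set psi x g | g in
                 [set g | F g /\ aw_dist N zctr f g <= rho%:E]]))%E.

End RandomLsc.

(* Main.v *)
Require Import Defs.
From mathcomp Require Import all_boot all_order all_algebra.
From mathcomp Require Import all_classical all_reals all_analysis.
From mathcomp Require Import measurable_realfun.
From mathcomp Require Import lra.

(* A bounded closed F is compact: along an ultrafilter on F, the 1-Lipschitz
   functions dist(., hypo f) converge pointwise, since they are bounded at the
   centre; the limit is again the distance to its zero set, which is the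
   hypograph of a usc function, and the convergence is uniform on bounded sets.
   Near f, the integrands psi(x, .) are bounded below by a local infimum h(x).
   Since a countable infimum of the psi(., f^n) is measurable and lies above h,
   its negative part has integral at most the lower integral of that of h; so
   Fatou's lemma gives lower semicontinuity of the integral without the
   measurability of h. A sum of lsc functions with values above -oo
   attains its minimum on the compact set F. *)

Set Implicit Arguments.
Unset Strict Implicit.
Unset Printing Implicit Defensive.

Import Order.TTheory GRing.Theory Num.Theory.
Import numFieldNormedType.Exports.
Local Open Scope classical_set_scope.
Local Open Scope ring_scope.

(** Compactness gives a cluster point [l] of the image filter. For a neighbourhood [B] of [l], the
    preimage of [B] or its complement lies in [U], and the second case would contradict clustering
    at [l]. *)
Lemma ultra_cvg_compact {X : Type} {T : topologicalType} (U : set_system X)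
    (h : X -> T) (K : set T) :
  UltraFilter U -> compact K -> U (h @^-1` K) ->
  exists l : T, h x @[x --> U] --> l.
Proof.
move=> UU cK UK; have [l [_ hl]] := cK (h @ U) _ UK.
exists l => B lB; have [//|nB] := in_ultra_setVsetC (h @^-1` B) UU.
by have [y []] := hl (~` B) B nB lB.
Qed.

(** * Equivalence of the arbitrary norm [N] with the canonical one *)

Section NormEquivalence.
Context {R : realType} {d : nat} (N : norm_on ('rV[R]_d * R)%type).
Implicit Types z w : ('rV[R]_d * R)%type.

Lemma norm_onN z : N (- z) = N z.
Proof. by rewrite -scaleN1r norm_homogeneous normrN1 mul1r. Qed.

Lemma norm_onB z w : N (z - w) = N (w - z).
Proof. by rewrite -norm_onN opprB. Qed.

Lemma norm_on_ge0 z : 0 <= N z.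
Proof.
rewrite -(@pmulrn_lge0 _ _ 2)// mulr2n -{2}norm_onN.
by apply: le_trans (norm_triangle N _ _); rewrite subrr norm0.
Qed.

Lemma norm_on_sum (I : Type) (r : seq I) (v : I -> 'rV[R]_d * R) :
  N (\sum_(i <- r) v i) <= \sum_(i <- r) N (v i).
Proof.
elim: r => [|i r IH]; first by rewrite !big_nil norm0.
rewrite !big_cons; apply: le_trans (norm_triangle N _ _) _.
by rewrite lerD2l.
Qed.

Lemma norm_on_distD u z w : N (z - w) <= N (z - u) + N (u - w).
Proof. by apply: le_trans (norm_triangle N _ _); rewrite addrA subrK. Qed.

Lemma norm_on_le : exists2 C, 0 < C & forall z, N z <= C * `|z|.
Proof.
pose e (j : 'I_d) : 'rV[R]_d * R := ('e_j, 0); pose f : 'rV[R]_d * R := (0, 1).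
(* The constant sums [N] over the standard basis, in which [z] is expanded; the summand 1 makes it
   visibly positive. *)
exists (\sum_(j < d) N (e j) + N f + 1).
  by rewrite ltr_wpDl// addr_ge0 ?norm_on_ge0// sumr_ge0// => j _; exact: norm_on_ge0.
move=> z; have zE : z = \sum_(j < d) z.1 0 j *: e j + z.2 *: f.
  rewrite [LHS]surjective_pairing [RHS]surjective_pairing; congr pair.
    rewrite /= scaler0 addr0 [LHS]row_sum_delta.
    by rewrite (raddf_sum (@fst 'rV[R]_d R)).
  rewrite /= (raddf_sum (@snd 'rV[R]_d R)) /= [_ *: 1]mulr1 big1 ?add0r//.
  by move=> j _; rewrite /= scaler0.
have z1 j : `|z.1 0 j| <= `|z|.
  rewrite prod_normE le_max; apply/orP; left.
  rewrite [leRHS]/Num.norm /= mx_normrE.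
  exact: (@le_bigmax _ _ _ _ (fun i : 'I_1 * 'I_d => `|z.1 i.1 i.2|) (0, j)).
have z2 : `|z.2| <= `|z| by rewrite prod_normE le_max lexx orbT.
rewrite {1}zE; apply: le_trans (norm_triangle N _ _) _.
rewrite !mulrDl mul1r -[leLHS]addr0; apply: lerD => //; apply: lerD; last first.
  by rewrite norm_homogeneous mulrC ler_wpM2l ?norm_on_ge0.
apply: le_trans (norm_on_sum _ _) _; rewrite mulr_suml ler_sum// => j _.
by rewrite norm_homogeneous mulrC ler_wpM2l ?norm_on_ge0.
Qed.

Lemma norm_on_cvg {X : Type} (U : set_system X) {FU : Filter U}
    (h : X -> 'rV[R]_d * R) (l : 'rV[R]_d * R) :
  h x @[x --> U] --> l -> forall e, 0 < e -> \forall x \near U, N (h x - l) <= e.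
Proof.
move=> hl e e0; have [C C0 NC] := norm_on_le.
move/cvgrPdist_le : hl => /(_ (e / C)); rewrite divr_gt0// => /(_ isT).
apply: filterS => x hx; apply: le_trans (NC _) _.
by rewrite mulrC -ler_pdivlMr// distrC.
Qed.

Lemma continuous_norm_on : continuous N.
Proof.
move=> z; apply/(@cvgrPdist_le _ R^o) => e e0.
have := @norm_on_cvg _ (nbhs z) (nbhs_filter z) id z cvg_id _ e0.
apply: filterS => w; apply: le_trans; rewrite ler_norml; apply/andP; split.
  by rewrite lerNl opprB lerBlDr -{1}(subrK z w) norm_triangle.
by rewrite norm_onB lerBlDr -{1}(subrK w z) norm_triangle.
Qed.

Lemma compact_closed_ball (r : R) :
  compact [set z : 'rV[R]_d * R | `|z| <= r].
Proof.
have -> : [set z : 'rV[R]_d * R | `|z| <= r] =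
    [set u : 'rV[R]_d | `|u| <= r] `*` [set t : R | `|t| <= r].
  apply/seteqP; split => z /=; rewrite prod_normE ge_max; first by move/andP.
  by move=> [-> ->].
apply: compact_setX; last first.
  rewrite (_ : mkset _ = `[- r, r]%classic); first exact: segment_compact.
  by apply/seteqP; split => t /=; rewrite in_itv/= ler_norml.
apply: bounded_closed_compact; last first.
  apply: (@preimage_closed _ _ (fun z : 'rV[R]_d => `|z|) [set t | t <= r]).
    by move=> u _; exact: norm_continuous.
  exact: closed_le.
by exists r; split; [exact: num_real | move=> M rM u /= /le_trans; apply; exact: ltW].
Qed.

(** The continuous function [N] attains its minimum on the compact canonical unit sphere, where
    definiteness makes it positive; homogeneity does the rest. *)
Lemma le_norm_on : exists2 c, 0 < c & forall z, `|z| <= c * N z.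
Proof.
pose Sph := [set z : 'rV[R]_d * R | `|z| = 1].
have [z0 z0S min0] : exists2 z0, z0 \in Sph & forall z, z \in Sph -> N z0 <= N z.
  apply: compact_EVT_min.
  (* This point lies on the sphere even when [d] is 0. *)
  - by exists (0, 1); rewrite /Sph/= prod_normE/= normr0 normr1 max_r.
  - apply: (subclosed_compact _ (@compact_closed_ball 1)).
      apply: (@preimage_closed _ _ (fun z : 'rV[R]_d * R => `|z|) [set t | t = 1]).
        by move=> u _; exact: norm_continuous.
      exact: closed_eq.
    by move=> z /= ->.
  - exact/continuous_subspaceT/continuous_norm_on.
have m0 : 0 < N z0.
  rewrite lt_neqAle norm_on_ge0 andbT eq_sym; apply/eqP => /norm_definite z00.
  by move: z0S; rewrite inE /Sph/= z00 normr0 => /eqP; rewrite eq_sym oner_eq0.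
exists (N z0)^-1; first by rewrite invr_gt0.
move=> z; have [->|z_neq0] := eqVneq z 0; first by rewrite normr0 norm0 mulr0.
have z_gt0 : 0 < `|z| by rewrite normr_gt0.
rewrite ler_pdivlMl// -ler_pdivlMr//.
apply: le_trans (min0 (`|z|^-1 *: z) _) _.
  by rewrite inE /Sph/= normrZ normfV normr_id mulVf ?gt_eqF.
by rewrite norm_homogeneous normfV normr_id mulrC.
Qed.

Lemma ultra_norm_on_cvg {X : Type} (U : set_system X)
    (h : X -> 'rV[R]_d * R) z r : UltraFilter U ->
  (\forall x \near U, N (h x - z) <= r) ->
  exists l, forall e, 0 < e -> \forall x \near U, N (h x - l) <= e.
Proof.
move=> UU hr; have [c c0 cN] := le_norm_on.
have [|l hl] := ultra_cvg_compact (h := h) UU (@compact_closed_ball (c * (r + N z))).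
  apply: filterS hr => x hr /=; apply: le_trans (cN _) _.
  rewrite ler_pM2l// -[h x](subrK z); apply: le_trans (norm_triangle _ _ _) _.
  by rewrite lerD2r.
by exists l; exact: norm_on_cvg hl.
Qed.

End NormEquivalence.

(** * Distances to sets and to hypographs *)

Section HypoDist.
Context {R : realType} {d : nat} {S : set 'rV[R]_d}.
Variable N : norm_on ('rV[R]_d * R)%type.
Implicit Types (f g : usc_fcns S) (z w : ('rV[R]_d * R)%type) (A : set ('rV[R]_d * R)%type).

Lemma set_dist_lbound z A : lbound [set N (z - w) | w in A] 0.
Proof. by move=> _ [w _ <-]; exact: norm_on_ge0. Qed.

Lemma set_dist_le z A w : A w -> set_dist N z A <= N (z - w).
Proof.
by move=> Aw; apply: ge_inf; [exists 0; exact: set_dist_lbound | exists w].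
Qed.

Lemma le_set_dist z A r : A !=set0 -> (forall w, A w -> r <= N (z - w)) ->
  r <= set_dist N z A.
Proof.
move=> [w Aw] rN; apply: lb_le_inf; first by exists (N (z - w)); exists w.
by move=> _ [v Av <-]; exact: rN.
Qed.

Lemma set_dist_ge0 z A : A !=set0 -> 0 <= set_dist N z A.
Proof. by move=> A0; apply: le_set_dist => // w _; exact: norm_on_ge0. Qed.

Lemma set_dist_adherent z A e : A !=set0 -> 0 < e ->
  exists2 w, A w & N (z - w) <= set_dist N z A + e.
Proof.
move=> [v Av] e0.
have [|_ [w Aw <-] /ltW] := @inf_adherent _ [set N (z - w) | w in A] _ e0.
  by split; [exists (N (z - v)); exists v | exists 0; exact: set_dist_lbound].
by exists w.
Qed.

Lemma set_dist_leD z w A : A !=set0 ->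
  set_dist N z A <= set_dist N w A + N (z - w).
Proof.
move=> A0; rewrite -lerBlDr; apply: le_set_dist => // v Av.
by rewrite lerBlDr addrC; apply: le_trans (set_dist_le _ Av) (norm_on_distD _ _ _ _).
Qed.

Lemma hypo_nonempty f : hypo f !=set0.
Proof.
have [x fx] := usc_neqNy f; exists (\val x, fine (f x)), x => //=.
by case: (f x) fx => //= *; rewrite ?leey.
Qed.

Lemma hypo_down f x a b : b <= a -> hypo f (x, a) -> hypo f (x, b).
Proof.
by move=> ba [y yx af]; exists y => //; apply: le_trans af; rewrite lee_fin.
Qed.

Lemma set_dist_hypo_homo f x a b : b <= a ->
  set_dist N (x, b) (hypo f) <= set_dist N (x, a) (hypo f).
Proof.
move=> ba; apply: le_set_dist (hypo_nonempty f) _ => -[y c] fyc.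
(* Both points are lowered by [a - b]; the second one stays in the hypograph. *)
have -> : (x, a) - (y, c) = (x, b) - (y, c - (a - b)).
  by congr pair => /=; rewrite opprB addrA addrC (addrC b) subrK addrC.
by apply/set_dist_le/hypo_down/fyc; rewrite gerBl subr_ge0.
Qed.

End HypoDist.

(** * Integrals of the exponential weight *)

Section ExponentialWeight.
Context {R : realType}.

Lemma integral_expRMN (k : R) : 0 < k ->
  (\int[lebesgue_measure]_(x in `[0%R, +oo[%classic) (expR (- (k * x)))%:E
    = k^-1%:E)%E.
Proof.
move=> k0; rewrite -[RHS]mule1 -(integral_exponential_pdf k0).
rewrite -ge0_integralZl//; last 3 first.
- by apply/measurable_EFinP; exact: measurable_exponential_pdf.
- by move=> x _; rewrite lee_fin exponential_pdf_ge0// ltW.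
- by rewrite lee_fin invr_ge0 ltW.
rewrite [LHS]integral_mkcond; apply: eq_integral => x _.
rewrite /exponential_pdf !patchE; case: ifP => _; last by rewrite mule0.
by rewrite -EFinM mulrA mulVf ?gt_eqF// mul1r mulNr.
Qed.

End ExponentialWeight.

(** * Bounds on the aw-distance by pointwise gaps of distance functions *)

Section AwDistEstimates.
Context {R : realType} {d : nat} {S : set 'rV[R]_d}.
Variables (N : norm_on ('rV[R]_d * R)%type) (zctr : S * R).
Implicit Types (f g : usc_fcns S).
Let ctr : 'rV[R]_d * R := (\val zctr.1, zctr.2).
Local Notation D f z := (set_dist N z (hypo f)).

Let measurable_weighted f g : measurable_fun (`[0, +oo[%classic : set R)
  (fun r => aw_dist_rho N zctr r f g * (expR (- r))%:E)%E.
Proof.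
apply: measurable_funTS; apply: emeasurable_funM.
  exact: measurable_aw_dist_rho.
apply/measurable_EFinP; exact: measurableT_comp.
Qed.

Lemma measurable_expRMN (k : R) (A : set R) :
  measurable_fun A (fun x : R => (expR (- (k * x)))%:E).
Proof.
apply: measurable_funTS; apply/measurable_EFinP.
apply: measurableT_comp => //; apply: measurableT_comp => //.
Qed.

(** The centre belongs to every ball over which the supremum is taken, and the weight has total mass
    1. Hence aw-boundedness controls the distances at the centre. *)
Lemma aw_dist_ge_ctr f g : (`|D f ctr - D g ctr|%:E <= aw_dist N zctr f g)%E.
Proof.
have := @integral_expRMN R 1 ltr01; rewrite invr1 => int1.
rewrite -[leLHS]mule1 -int1 -ge0_integralZl//; last exact: measurable_expRMN.
apply: ge0_le_integral => //.
- by apply: emeasurable_funM => //; exact: measurable_expRMN.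
- exact: measurable_weighted.
move=> r; rewrite /= in_itv/= andbT => r0; rewrite mul1r.
rewrite lee_wpmul2r ?lee_fin ?expR_ge0//; apply: ereal_sup_ubound.
by exists ctr => //=; rewrite subrr norm0.
Qed.

(* The weight exp (- rho) leaves room for an error growing like exp (rho / 2). *)
Lemma aw_dist_le f g e : 0 <= e ->
  (forall z, `|D f z - D g z| <= e * expR (N (z - ctr) / 2)) ->
  (aw_dist N zctr f g <= (e * 2)%:E)%E.
Proof.
move=> e0 De; have := @integral_expRMN R 2^-1; rewrite invrK => int2.
rewrite EFinM -int2// -ge0_integralZl//; last exact: measurable_expRMN.
apply: ge0_le_integral => //.
- move=> x; rewrite /= in_itv/= andbT => x0.
  by rewrite mule_ge0 ?aw_dist_rho_ge0// lee_fin expR_ge0.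
- exact: measurable_weighted.
- by apply: emeasurable_funM => //; exact: measurable_expRMN.
move=> r; rewrite /= in_itv/= andbT => r0.
have -> : expR (- (2^-1 * r)) = expR (r / 2) * expR (- r).
  by rewrite -expRD; congr expR; rewrite mulrC {3}[r]splitr opprD addNKr.
rewrite EFinM muleA lee_wpmul2r ?lee_fin ?expR_ge0//.
apply: ge_ereal_sup => _ [z /= zr <-]; rewrite -EFinM lee_fin.
by apply: le_trans (De z) _; rewrite ler_wpM2l// ler_expR ler_pM2r.
Qed.

End AwDistEstimates.

(** * Limits of hypographs along an ultrafilter *)

Section UltraLimit.
Context {R : realType} {d : nat} {S : set 'rV[R]_d}.
Variables (N : norm_on ('rV[R]_d * R)%type) (zctr : S * R).
Variables (U : set_system (usc_fcns S)) (K : R).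
Hypothesis S_closed : closed S.
Hypothesis UU : UltraFilter U.
Let ctr : 'rV[R]_d * R := (\val zctr.1, zctr.2).
Local Notation D f z := (set_dist N z (hypo f)).
Hypothesis UK : \forall f \near U, D f ctr <= K.

Lemma ultra_dist_cvg : exists Dl : 'rV[R]_d * R -> R,
  forall z e, 0 < e -> \forall f \near U, `|D f z - Dl z| <= e.
Proof.
suff H : forall z, exists l, forall e, 0 < e -> \forall f \near U, `|D f z - l| <= e.
  by have [Dl DlP] := boolp.choice H; exists Dl.
move=> z.
have [|l /cvgrPdist_le hl] := ultra_cvg_compact (h := fun f => D f z) UU
    (@segment_compact R 0 (K + N (z - ctr))).
  apply: filterS UK => f fK; rewrite /= in_itv/= set_dist_ge0/=; last exact: hypo_nonempty.
  by apply: le_trans (set_dist_leD _ _ ctr (hypo_nonempty f)) _; rewrite lerD2r.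
by exists l => e /hl; apply: filterS => f; rewrite distrC.
Qed.

Variable Dl : 'rV[R]_d * R -> R.
Hypothesis DlP : forall z e, 0 < e -> \forall f \near U, `|D f z - Dl z| <= e.

(** The inequality passes to the limit because a single [f] approximates [Dl] at both points; the
    next inequalities are obtained in the same way. *)
Lemma ultra_dist_leD z w : Dl z <= Dl w + N (z - w).
Proof.
apply/ler_addgt0Pr => e e0; have e20 : 0 < e / 2 by rewrite divr_gt0.
have [f [fz fw]] := filter_ex (filterI (DlP z e20) (DlP w e20)).
have := set_dist_leD N z w (hypo_nonempty f).
move: fz fw; rewrite !ler_norml => /andP[fz _] /andP[_ fw].
lra.
Qed.

Lemma ultra_dist_ge0 z : 0 <= Dl z.
Proof.
apply/ler_addgt0Pr => e e0; have [f fz] := filter_ex (DlP z e0).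
have := set_dist_ge0 N z (hypo_nonempty f).
by move: fz; rewrite !ler_norml => /andP[_ fz]; lra.
Qed.

Lemma ultra_dist_homo x a b : b <= a -> Dl (x, b) <= Dl (x, a).
Proof.
move=> ba; apply/ler_addgt0Pr => e e0; have e20 : 0 < e / 2 by rewrite divr_gt0.
have [f [fa fb]] := filter_ex (filterI (DlP (x, a) e20) (DlP (x, b) e20)).
have := set_dist_hypo_homo N f x ba.
move: fa fb; rewrite !ler_norml => /andP[_ fa] /andP[fb _].
lra.
Qed.

Lemma ultra_dist_le0 z : (forall e, 0 < e -> Dl z <= e) -> Dl z = 0.
Proof.
move=> zle; apply/eqP; rewrite eq_le ultra_dist_ge0 andbT.
by apply/ler_addgt0Pr => e e0; rewrite add0r zle.
Qed.

(** Almost nearest points [h f] of the hypographs stay bounded, so they converge along [U] to some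
    [l]. Since [D f l] is at most the distance from [l] to [h f], [Dl] vanishes at [l]. Thus [Dl] is
    no smaller than the distance to its zero set. *)
Lemma ultra_dist_adherent z e : 0 < e ->
  exists2 w, Dl w = 0 & N (z - w) <= Dl z + e.
Proof.
move=> e0; have e20 : 0 < e / 2 by rewrite divr_gt0.
have hE (f : usc_fcns S) : exists w, hypo f w /\ N (z - w) <= D f z + e / 2.
  by have [w] := set_dist_adherent N z (hypo_nonempty f) e20; exists w.
have [h hP] := boolp.choice hE.
have hz : \forall f \near U, N (z - h f) <= Dl z + e.
  apply: filterS (DlP z e20) => f; rewrite ler_norml => /andP[_ fz].
  by have [_] := hP f; lra.
have [|l hl] := @ultra_norm_on_cvg _ _ N _ U h z (Dl z + e) UU.
  by apply: filterS hz => f; rewrite norm_onB.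
exists l.
  apply: ultra_dist_le0 => e' e'0; have e'20 : 0 < e' / 2 by rewrite divr_gt0.
  have [f [fl]] := filter_ex (filterI (DlP l e'20) (hl _ e'20)).
  have := set_dist_le N l (proj1 (hP f)); rewrite norm_onB.
  by move: fl; rewrite ler_norml => /andP[fl _]; lra.
apply/ler_addgt0Pr => e' e'0.
have [f [fz fl]] := filter_ex (filterI hz (hl _ e'0)).
by have := norm_on_distD N (h f) z l; lra.
Qed.

(** Closedness of [S] enters here: a zero of [Dl] is approached by points of hypographs, whose first
    components lie in [S]. *)
Lemma ultra_dist0_closed z : Dl z = 0 -> S z.1.
Proof.
move=> z0; apply: S_closed => B /nbhs_ballP[e /= e0 eB].
have [c c0 cN] := le_norm_on N.
(* Two errors of this size, one from [DlP] and one from the almost nearest point, stay below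
   [e / c], hence below [e] in the canonical norm. *)
have e'0 : 0 < e / c / 4 by rewrite !divr_gt0.
have [f] := filter_ex (DlP z e'0); rewrite z0 subr0 => fz.
have [w [x xw _] wz] := set_dist_adherent N z (hypo_nonempty f) e'0.
exists w.1; split; first by rewrite -xw; exact: set_valP.
apply: eB; rewrite -ball_normE /=.
apply: (@le_lt_trans _ _ `|z - w|); first by rewrite prod_normE le_max lexx.
apply: le_lt_trans (cN _) _; rewrite mulrC -ltr_pdivlMr//.
have ec : 0 < e / c by rewrite divr_gt0.
move: fz; rewrite ler_norml => /andP[_ fz]; lra.
Qed.

Let lim_val (x : S) : \bar R := ereal_sup [set a%:E | a in [set a | Dl (\val x, a) = 0]].

(** The zeros of [Dl] above [x] form a set that is downward closed, by monotonicity, and closed, by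
    the Lipschitz bound. So they are exactly the reals below its supremum. *)
Let lim_valP x b : (b%:E <= lim_val x)%E <-> Dl (\val x, b) = 0.
Proof.
split=> [bx|xb]; last by apply: ereal_sup_ubound; exists b.
have [C C0 NC] := norm_on_le N.
apply: ultra_dist_le0 => e e0; have eC : 0 < e / C by rewrite divr_gt0.
have [|_ [a /= xa <-]] := @ereal_sup_gt _ _ (b - e / C)%:E (_ : _ < lim_val x)%E.
  by apply: lt_le_trans bx; rewrite lte_fin gtrBl.
rewrite lte_fin => /ltW ba.
apply: le_trans (ultra_dist_leD _ (\val x, b - e / C)) _.
have := ultra_dist_homo (\val x) ba; rewrite xa => xb.
apply: le_trans (lerD xb (NC _)) _; rewrite add0r prod_normE/= subrr normr0.
by rewrite subKr max_r// gtr0_norm// mulrC divfK ?gt_eqF.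
Qed.

(** [lim_val x] is below [- a] exactly when [Dl] is positive at height [- a] over [x], and the
    Lipschitz bound preserves positivity near [x]. *)
Let lim_val_usc : lower_semicontinuous (\- lim_val)%E.
Proof.
move=> x a ax; have [C C0 NC] := norm_on_le N.
have xa : 0 < Dl (\val x, - a).
  rewrite lt_neqAle ultra_dist_ge0 andbT eq_sym; apply/eqP => /lim_valP.
  by rewrite EFinN leeNl leNgt ax.
exists [set y : S | Dl (\val y, - a) != 0]; last first.
  move=> y /= ya; rewrite lteNr -EFinN ltNge; apply: contra ya => ya.
  exact/eqP/lim_valP.
have : nbhs (\val x) (ball (\val x) (Dl (\val x, - a) / C)).
  by apply: nbhsx_ballx; rewrite divr_gt0.
move=> /(@initial_continuous S 'rV[R]_d set_val x); apply: (@filterS _ (nbhs x)) => y.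
rewrite /= -ball_normE/= ltr_pdivlMr// => xy.
have := ultra_dist_leD (\val x, - a) (\val y, - a).
apply: contraTneq => ->; rewrite add0r -ltNge; apply: le_lt_trans (NC _) _.
by rewrite prod_normE/= subrr normr0 max_l// mulrC.
Qed.

Let lim_val_neqNy : exists x, lim_val x != -oo%E.
Proof.
have [w w0 _] := @ultra_dist_adherent 0 1 ltr01.
exists (exist _ w.1 (mem_set (ultra_dist0_closed w0))).
rewrite -ltNye; apply: (@lt_le_trans _ _ w.2%:E); first exact: ltNyr.
by apply/lim_valP; rewrite /= -surjective_pairing.
Qed.

(** The hypograph of [lim_val] is the zero set of [Dl]. Almost nearest zeros give one inequality,
    and the Lipschitz bound from a zero gives the other. *)
Lemma ultra_hypo_limit : exists g : usc_fcns S, forall z, D g z = Dl z.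
Proof.
exists (UscFcns lim_val_usc lim_val_neqNy) => z; set g := UscFcns _ _.
have gE w : hypo g w <-> Dl w = 0.
  split=> [[x xw /lim_valP]|w0]; first by rewrite xw -surjective_pairing.
  exists (exist _ w.1 (mem_set (ultra_dist0_closed w0))) => //.
  by apply/lim_valP; rewrite /= -surjective_pairing.
apply/eqP; rewrite eq_le; apply/andP; split.
  apply/ler_addgt0Pr => e e0; have [w w0 zw] := ultra_dist_adherent z e0.
  by apply: le_trans zw; apply/set_dist_le/gE.
apply: le_set_dist (hypo_nonempty g) _ => w /gE w0.
by have := ultra_dist_leD z w; rewrite w0 add0r.
Qed.

(* Points violating the bound stay in a bounded set, because exp (r / 2) beats
   1 + 2 r, so they converge along U, where the Lipschitz bounds contradict
   pointwise convergence at their limit. *)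
Lemma ultra_dist_uniform e : 0 < e ->
  \forall f \near U, forall z, `|D f z - Dl z| <= e * expR (N (z - ctr) / 2).
Proof.
move=> e0; pose P (f : usc_fcns S) := forall z, `|D f z - Dl z| <= e * expR (N (z - ctr) / 2).
have [//|UnP] := in_ultra_setVsetC P UU.
have hE (f : usc_fcns S) : exists z, ~ P f -> e * expR (N (z - ctr) / 2) < `|D f z - Dl z|.
  have [Pf|/existsNP[z /negP]] := pselect (P f); first by exists 0.
  by rewrite -ltNge; exists z.
have [h hP] := boolp.choice hE.
have hbnd : \forall f \near U, N (h f - ctr) <= 32 / e.
  apply: filterS (filterI UnP (DlP ctr (@ltr01 R))) => f [/hP hf fc]; rewrite ler_pdivlMr//.
  set r := N (h f - ctr) in hf *.
  have r0 : 0 <= r := norm_on_ge0 _ _.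
  have expr : (1 + r / 4) * (1 + r / 4) <= expR (r / 2).
    have -> : r / 2 = r / 4 + r / 4 by lra.
    by rewrite expRD ler_pM ?expR_ge1Dx// addr_ge0// divr_ge0.
  have hD : `|D f (h f) - Dl (h f)| <= 1 + 2 * r.
    have := set_dist_leD N (h f) ctr (hypo_nonempty f).
    have := set_dist_leD N ctr (h f) (hypo_nonempty f).
    have := ultra_dist_leD (h f) ctr; have := ultra_dist_leD ctr (h f).
    rewrite (norm_onB _ ctr) -/r; move: fc; rewrite !ler_norml => /andP[? ?] *.
    by apply/andP; split; lra.
  have er : e * ((1 + r / 4) * (1 + r / 4)) < 1 + 2 * r.
    by apply: le_lt_trans (lt_le_trans hf hD); rewrite ler_pM2l.
  (* If [r * e] exceeded 32, then the terms [e * r / 2] and [e * r * r / 16] of the expanded square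
     would exceed 1 and [2 * r]. *)
  rewrite leNgt; apply/negP => re; nra.
have [l hl] := @ultra_norm_on_cvg _ _ N _ U h ctr _ UU hbnd.
(* The gap at [l] and two Lipschitz errors between [h f] and [l] add up to at most three quarters of
   [e]. *)
have e40 : 0 < e / 4 by rewrite divr_gt0.
have [f [[fP fl] fhl]] := filter_ex (filterI (filterI UnP (DlP l e40)) (hl _ e40)).
have := hP f fP; rewrite ltNge => /negP[].
apply: (@le_trans _ _ e); last first.
  rewrite ler_peMr ?(ltW e0)//; apply: le_trans (expR_ge1Dx _).
  by rewrite lerDl divr_ge0 ?norm_on_ge0.
have := set_dist_leD N (h f) l (hypo_nonempty f).
have := set_dist_leD N l (h f) (hypo_nonempty f).
have := ultra_dist_leD (h f) l; have := ultra_dist_leD l (h f).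
rewrite (norm_onB _ l); move: fl; rewrite !ler_norml => /andP[? ?] *.
by apply/andP; split; lra.
Qed.

End UltraLimit.

(** * Compactness of closed bounded sets of usc functions *)

Lemma aw_bounded_closed_compact {R : realType} {d : nat} {S : set 'rV[R]_d}
    (N : norm_on ('rV[R]_d * R)%type) (zctr : S * R) (F : set (aw_space N zctr)) :
  closed S -> closed F -> aw_bounded F -> compact F.
Proof.
move=> S_closed F_closed [M FM]; rewrite compact_ultra => U UU UF.
have [f0 Ff0] := filter_ex UF.
pose ctr : 'rV[R]_d * R := (\val zctr.1, zctr.2).
have UK : \forall f \near (U : set_system (usc_fcns S)),
    set_dist N ctr (hypo f) <= M + set_dist N ctr (hypo f0).
  apply: filterS UF => f Ff.
  have := le_trans (aw_dist_ge_ctr N zctr f f0) (FM _ _ Ff Ff0).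
  by rewrite lee_fin => /(le_trans (ler_norm _)); rewrite lerBlDr.
have [Dl DlP] := ultra_dist_cvg UU UK.
have [g gE] := ultra_hypo_limit S_closed UU DlP.
have Ug : U --> (g : aw_space N zctr).
  move=> B /nbhs_ballP[e /= e0 eB].
  (* [aw_dist_le] doubles the constant, which leaves [e / 2], strictly below [e]. *)
  have e40 : 0 < e / 4 by rewrite divr_gt0.
  apply: filterS (ultra_dist_uniform zctr UU DlP e40) => f fD; apply: eB.
  rewrite aw_ballE/= aw_distC; apply: le_lt_trans (aw_dist_le (ltW e40) _) _.
    by move=> z; rewrite gE; exact: fD.
  by rewrite lte_fin; lra.
exists g; split => //; apply: F_closed => B /Ug UB.
exact: filter_ex (filterI UF UB).
Qed.

(** * Lower limits and sums in the extended reals *)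

Section ErealSequences.
Context {R : realType}.
Local Open Scope ereal_scope.
Implicit Types (u v : (\bar R)^nat) (a b l x y : \bar R).

Lemma einfs_gt_near u a : a < limn_einf u -> \forall n \near \oo, a < einfs u n.
Proof.
rewrite limn_einf_lim (cvg_lim _ (@cvg_einfs_sup _ u))//.
move=> /ereal_sup_gt[_ [N _ <-] aN]; exists N => // n /= Nn.
by apply: lt_le_trans aN _; exact: nondecreasing_einfs.
Qed.

Lemma einfs_le u n : einfs u n <= u n.
Proof. by apply: ereal_inf_lbound; exists n => /=. Qed.

Lemma limn_einf_gt_near u a : a < limn_einf u -> \forall n \near \oo, a < u n.
Proof.
move=> /einfs_gt_near; apply: filterS => n /lt_le_trans; apply.
exact: einfs_le.
Qed.

Lemma cvge_gt_near u a l : u @ \oo --> l -> a < l -> \forall n \near \oo, a < u n.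
Proof.
move=> ul al; have : nbhs l [set y | a < y].
  by apply: open_nbhs_nbhs; split => //; exact: open_ereal_gt_ereal.
by move=> /ul.
Qed.

Lemma nondecreasing_cvge_sup u l : nondecreasing_seq u -> (forall n, u n <= l) ->
  (forall a, a < l -> \forall n \near \oo, a < u n) -> u @ \oo --> l.
Proof.
move=> ndu ul lu; have := ereal_nondecreasing_cvgn ndu.
suff -> : ereal_sup (range u) = l by [].
apply/eqP; rewrite eq_le; apply/andP; split.
  by apply: ge_ereal_sup => _ [n _ <-].
rewrite leNgt; apply/negP => /lu[N _ /(_ N (leqnn N))] /=.
by apply/negP; rewrite -leNgt; apply: ereal_sup_ubound; exists N.
Qed.

Lemma ereal_dense x y : x < y -> exists2 z, x < z & z < y.
Proof.
case: x y => [r| |] [s| |] //= rs.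
- by exists ((r + s) / 2)%:E; rewrite lte_fin midf_lt.
- by exists (r + 1)%:E; rewrite ?ltry// lte_fin ltrDl.
- by exists (s - 1)%:E; rewrite ?ltNyr// lte_fin gtrBl.
- by exists 0; rewrite ?ltry ?ltNyr.
Qed.

Lemma real_below x : -oo < x -> exists r : R, r%:E < x.
Proof.
move=> /ereal_dense[z]; case: z => [r _ rx|_|//]; first by exists r.
by rewrite ltNge leey.
Qed.

(** Lower semicontinuity is expressed by eventual strict lower bounds. In this form it passes to
    sums, since a bound below [x + y] splits into a bound below [x] and one below [y]. *)
Lemma near_gt_add u v x y : -oo < x -> -oo < y ->
  (forall a, a < x -> \forall n \near \oo, a < u n) ->
  (forall a, a < y -> \forall n \near \oo, a < v n) ->
  forall a, a < x + y -> \forall n \near \oo, a < u n + v n.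
Proof.
move=> x0 y0 ux vy a axy.
have [[b c] [/= bx cy abc]] : exists bc : \bar R * \bar R,
    [/\ bc.1 < x, bc.2 < y & forall s t, bc.1 < s -> bc.2 < t -> a < s + t].
  case: a axy => [r||]; last 2 first.
  - by rewrite ltNge leey.
  - move=> _; exists (-oo, -oo); split => // s t /=.
    by rewrite !ltNye adde_eq_ninfty negb_or => -> ->.
  move=> rxy; suff [b [c [bx cy rbc]]] : exists b c : R,
      [/\ b%:E < x, c%:E < y & (r <= b + c)%R].
    exists (b%:E, c%:E); split => //= s t bs ct.
    by apply: (@le_lt_trans _ _ (b%:E + c%:E)); [rewrite -EFinD lee_fin | exact: lteD].
  have [c cy] := real_below y0; have [b bx] := real_below x0.
  case: x y x0 y0 rxy bx cy {ux vy} => [x| |] [y| |] //= _ _ rxy bx cy.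
  (* The slack [x + y - r] is shared equally; in the other cases an infinite term absorbs whatever
     is missing. *)
  - exists (x - (x + y - r) / 2)%R, (y - (x + y - r) / 2)%R.
    by move: rxy; rewrite -EFinD !lte_fin => rxy; split; lra.
  - by exists b, (r - b)%R; rewrite ltry; split => //; lra.
  - by exists (r - c)%R, c; rewrite ltry; split => //; lra.
  - by exists b, (r - b)%R; rewrite !ltry; split => //; lra.
by apply: filterS2 (ux _ bx) (vy _ cy) => n; exact: abc.
Qed.

Lemma dual_addeE x y : -oo < x -> -oo < y -> (x + y)%dE = x + y.
Proof. by case: x y => [x| |] [y| |]. Qed.

End ErealSequences.

(** * A Fatou lemma with a minorant that may be nonmeasurable *)

Section IntegralPinfty.
Context {disp : measure_display} {T : measurableType disp} {R : realType}.
Variable mu : {measure set T -> \bar R}.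
Local Open Scope ereal_scope.
Implicit Types (f g h : T -> \bar R).

(* Neither function is assumed measurable: [\int] is then the lower integral. *)
Lemma ge0_le_lower_integral f g : (forall x, 0 <= f x) ->
  (forall x, f x <= g x) -> \int[mu]_x f x <= \int[mu]_x g x.
Proof.
move=> f0 fg; have g0 x : 0 <= g x := le_trans (f0 x) (fg x).
rewrite !ge0_integralTE//; apply: ereal_sup_le => _ [h /= hf <-].
by exists h => // x; exact: le_trans (hf x) (fg x).
Qed.

Lemma integral_pinftyE f : \int[mu]_x f^\- x < +oo ->
  integral_pinfty mu f = \int[mu]_x f^\+ x - \int[mu]_x f^\- x.
Proof.
move=> fy; rewrite /integral_pinfty dual_addeE//.
  by apply: lt_le_trans (integral_ge0 _ _).
by rewrite lteNr.
Qed.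

Lemma integral_pinfty_y f : \int[mu]_x f^\+ x = +oo -> integral_pinfty mu f = +oo.
Proof. by rewrite /integral_pinfty => ->. Qed.

Lemma integral_pinfty_gtNy h : -oo < integral_pinfty mu h ->
  \int[mu]_x h^\+ x = +oo \/ \int[mu]_x h^\- x < +oo.
Proof.
rewrite /integral_pinfty; case: (\int[mu]_x h^\+ x) => [r| |]; last 2 first.
- by left.
- by case: (\int[mu]_x h^\- x) => [s| |] //; right; rewrite ?ltry.
by case: (\int[mu]_x h^\- x) => [s| |] // _; right; rewrite ?ltry.
Qed.

(** If the positive part of [h] has infinite integral, every integral above [h] is [+oo] by the
    convention on [+oo - +oo]. Otherwise all negative parts have finite integral, and the two parts
    are passed to the limit separately. *)
Lemma fatou_integral_pinfty (h f : T -> \bar R) (u : (T -> \bar R)^nat) :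
  -oo < integral_pinfty mu h ->
  measurable_fun setT f -> (forall n, measurable_fun setT (u n)) ->
  (forall x, h x <= f x) -> (forall n x, h x <= u n x) ->
  (forall x, f x <= limn_einf (u ^~ x)) ->
  -oo < integral_pinfty mu f /\
  forall a, a < integral_pinfty mu f -> \forall n \near \oo, a < integral_pinfty mu (u n).
Proof.
move=> /integral_pinfty_gtNy h_gtNy mf mun hf hu fu.
have lepos f1 f2 : (forall x, f1 x <= f2 x) -> forall x, f1^\+ x <= f2^\+ x.
  by move=> f12 x; rewrite !funeposE ge_max !le_max f12 lexx orbT.
have leneg f1 f2 : (forall x, f1 x <= f2 x) -> forall x, f2^\- x <= f1^\- x.
  by move=> f12 x; rewrite !funenegE ge_max !le_max leeN2 f12 lexx orbT.
case: h_gtNy => [hy|hy].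
  have Iy g : (forall x, h x <= g x) -> integral_pinfty mu g = +oo.
    move=> hg; apply: integral_pinfty_y; apply/eqP; rewrite -leye_eq -hy.
    by apply: ge0_le_lower_integral => //; exact: lepos.
  by rewrite Iy//; split => // a ay; apply: nearW => n; rewrite Iy.
have negy g : (forall x, h x <= g x) -> \int[mu]_x g^\- x < +oo.
  move=> hg; apply: le_lt_trans hy.
  by apply: ge0_le_lower_integral => //; exact: leneg.
(* Capping the tail infima at [f] makes them increase to [f] itself, although [f] is only below the
   lower limit. *)
pose G n x := mine (f x) (einfs (u ^~ x) n).
have mG n : measurable_fun setT (G n).
  by apply: measurable_mine => //; exact: measurable_fun_einfs.
have hG n x : h x <= G n x.
  by rewrite le_min hf/=; apply: le_ereal_inf_tmp => _ [k _ <-].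
have Gf n x : G n x <= f x by rewrite ge_min lexx.
have Gu n x : G n x <= u n x by rewrite ge_min einfs_le orbT.
have Gnd x : nondecreasing_seq (G ^~ x).
  by move=> m n mn; rewrite /G le_min2// nondecreasing_einfs.
have Gnear x a : a < f x -> \forall n \near \oo, a < G n x.
  move=> af; have := einfs_gt_near (lt_le_trans af (fu x)).
  by apply: filterS => n an; rewrite lt_min af.
have Gp x : (G n)^\+ x @[n --> \oo] --> f^\+ x.
  apply: nondecreasing_cvge_sup => [m n mn|n|a].
  - by apply: lepos => y; exact: Gnd.
  - exact: lepos.
  rewrite funeposE lt_max => /orP[/Gnear|a0].
    by apply: filterS => n an; rewrite funeposE lt_max an.
  by apply: nearW => n; rewrite funeposE lt_max a0 orbT.
have Gm x : (G n)^\- x @[n --> \oo] --> f^\- x.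
  have -> : (fun n => (G n)^\- x) = (fun n => - - (G n)^\- x).
    by apply/funext => n; rewrite oppeK.
  rewrite -[f^\- x]oppeK; apply: cvgeN.
  apply: nondecreasing_cvge_sup => [m n mn|n|a].
  - by rewrite leeN2; apply: leneg => y; exact: Gnd.
  - by rewrite leeN2; exact: leneg.
  rewrite lteNr funenegE gt_max lteNl oppeK => /andP[/Gnear fa a0].
  by apply: filterS fa => n an; rewrite lteNr funenegE gt_max lteNl oppeK an.
have intp : \int[mu]_x (G n)^\+ x @[n --> \oo] --> \int[mu]_x f^\+ x.
  have -> : \int[mu]_x f^\+ x = \int[mu]_x limn (fun n => (G n)^\+ x).
    by apply: eq_integral => x _; apply/esym/cvg_lim.
  apply: cvg_monotone_convergence => //.
  - by move=> n; exact: measurable_funepos.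
  - by move=> x _ m n mn; apply: lepos => y; exact: Gnd.
have intm : \int[mu]_x (G n)^\- x @[n --> \oo] --> \int[mu]_x f^\- x.
  (* The negative parts decrease, so the first one dominates; it is measurable, whereas the negative
     part of [h] may fail to be. *)
  have [|||||//] := @dominated_convergence _ _ _ mu setT measurableT
    (fun n => (G n)^\-) f^\- (G 0%N)^\-.
  - by move=> n; exact: measurable_funeneg.
  - exact: measurable_funeneg.
  - by apply: aeW => x _; exact: Gm.
  - apply/integrableP; split; first exact: measurable_funeneg.
    under eq_integral do rewrite gee0_abs//.
    exact: negy.
  - apply: aeW => x n _; rewrite gee0_abs//; apply: leneg => y; exact: Gnd.
have fin g : (forall x, h x <= g x) -> \int[mu]_x g^\- x \is a fin_num.
  move=> hg; rewrite ge0_fin_numE ?negy//; exact: integral_ge0.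
rewrite integral_pinftyE ?negy//; split.
  rewrite ltNye adde_eq_ninfty negb_or -!ltNye; apply/andP; split.
    by apply: lt_le_trans (integral_ge0 _ _).
  by rewrite lteNr; exact: negy.
move=> a af; have dfn : \int[mu]_x f^\+ x +? - \int[mu]_x f^\- x.
  by rewrite fin_num_adde_defl// fin_numN fin.
apply: filterS (cvge_gt_near (cvgeB dfn intp intm) af) => n /lt_le_trans; apply.
rewrite integral_pinftyE ?negy//; apply: leeB.
  by apply: ge0_le_lower_integral => //; exact: lepos.
by apply: ge0_le_lower_integral => //; exact: leneg.
Qed.

End IntegralPinfty.

(** * Existence of minimizers on compact sets *)

(** The sublevel sets above the infimum [m] generate a proper filter, which clusters at some [f] in
    [F]. If [phi f] exceeded [m], a sublevel set at a level between them would contain a sequence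
    tending to [f], against lower semicontinuity. *)
Lemma compact_seq_lsc_min {R : realType} {X : pseudoMetricType R} (F : set X)
    (phi : X -> \bar R) : compact F -> F !=set0 ->
  (forall (u : nat -> X) f, (forall n, F (u n)) -> F f -> u @ \oo --> f ->
     forall a, (a < phi f)%E -> \forall n \near \oo, (a < phi (u n))%E) ->
  exists2 f, F f & forall g, F g -> (phi f <= phi g)%E.
Proof.
move=> F_compact [f0 Ff0] phi_lsc.
pose m := ereal_inf [set phi f | f in F].
have mF g : F g -> (m <= phi g)%E by move=> Fg; apply: ereal_inf_lbound; exists g.
have [/eqP my|m_lty] := boolP (m == +oo%E).
  by exists f0 => // g /mF; rewrite my leye_eq => /eqP ->; exact: leey.
rewrite -ltey in m_lty.
pose B (a : \bar R) := F `&` [set f | (phi f < a)%E].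
pose G := filter_from [set a | (m < a)%E] B.
have FG : Filter G.
  apply: filter_from_filter; first by exists +oo%E.
  move=> a b /= ma mb; exists (mine a b); first by rewrite /= lt_min ma.
  by move=> f [Ff /=]; rewrite lt_min => /andP[fa fb].
have PG : ProperFilter G.
  apply: filter_from_proper => a /= /ereal_inf_lt[_ [f Ff <-] fa].
  by exists f.
have GF : G F by exists +oo%E => //= f [].
have [f [Ff Gf]] := F_compact G PG GF.
exists f => // g Fg; apply: le_trans (mF g Fg).
rewrite leNgt; apply/negP => /ereal_dense[a ma af].
have uE (n : nat) : exists g, B a g /\ ball f n.+1%:R^-1 g.
  have [] := Gf (B a) (ball f n.+1%:R^-1); first by exists a.
    by apply: nbhsx_ballx; rewrite invr_gt0.
  by move=> h [? ?]; exists h.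
have [u uP] := boolp.choice uE.
have uf : u @ \oo --> f.
  apply/cvg_ballP => e e0.
  apply: filterS (near_infty_natSinv_lt (PosNum e0)) => n /ltW ne.
  by apply: le_ball ne _ _; have [] := uP n.
have [N _ /(_ N (leqnn N))] := phi_lsc u f (fun n => proj1 (proj1 (uP n))) Ff uf a af.
by have [[_ /=]] := uP N; move=> /ltW; rewrite leNgt => /negP.
Qed.

(** * Lower semicontinuity of the integral functional *)

Section IntegralLsc.
Context {R : realType} {d : nat} {S : set 'rV[R]_d}.
Context {N : norm_on ('rV[R]_d * R)%type} {zctr : S * R}.
Context {disp : measure_display} {T : measurableType disp}.
Variables (P : {measure set T -> \bar R}) (F : set (aw_space N zctr)).
Variable psi : T -> aw_space N zctr -> \bar R.
Hypothesis F_closed : closed F.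
Hypothesis psi_lsc : random_lsc F psi.
Hypothesis psi_inf : locally_inf_integrable P F psi.

Lemma random_lsc_measurable f : F f -> measurable_fun setT (psi^~ f).
Proof.
move=> Ff; have [_ mpsi] := psi_lsc.
apply: (@measurable_comp _ _ _ _ _ _ (setT `*` (F : set (aw_borel (N:=N) (zctr:=zctr))))
  (fun xf : T * aw_borel => psi xf.1 xf.2) setT (fun x => (x, f : aw_borel))) => //.
- apply: measurableX => //; rewrite -[F]setCK; apply: measurableC.
  by apply: sub_sigma_algebra; exact: closed_openC.
- by move=> _ [x _ <-].
Qed.

Lemma integral_pinfty_lsc (u : nat -> aw_space N zctr) f :
  (forall n, F (u n)) -> F f -> u @ \oo --> f ->
  (-oo < integral_pinfty P (psi^~ f))%E /\
  forall a, (a < integral_pinfty P (psi^~ f))%E ->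
    \forall n \near \oo, (a < integral_pinfty P (psi^~ (u n)))%E.
Proof.
move=> Fu Ff uf; have [rho rho0 hNy] := psi_inf Ff.
have [k _ uk] : \forall n \near \oo, (aw_dist N zctr f (u n) <= rho%:E)%E.
  move/cvg_ballP : uf => /(_ _ rho0); apply: filterS => n.
  by rewrite aw_ballE/= => /ltW.
(* The local infimum minorizes [psi] only within [rho] of [f], so the first [k] terms are
   dropped. *)
pose v n := u (n + k)%N.
have vf : v @ \oo --> f by rewrite (cvg_shiftn k u).
have [|||||fNy flsc] := @fatou_integral_pinfty _ _ _ P _ (psi^~ f) (fun n => psi^~ (v n)) hNy.
- exact: random_lsc_measurable.
- by move=> n; apply: random_lsc_measurable; exact: Fu.
- move=> x; apply: ereal_inf_lbound; exists f => //; split => //.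
  by rewrite aw_distxx lee_fin ltW.
- move=> n x; apply: ereal_inf_lbound; exists (v n) => //; split; first exact: Fu.
  by apply: uk; rewrite /= leq_addl.
- by move=> x; have [lscx _] := psi_lsc; apply: (lscx x v f) => // n; exact: Fu.
split=> // a /flsc [j _ ja]; exists (j + k)%N => // n /= jkn.
have kn : (k <= n)%N by apply: leq_trans jkn; exact: leq_addl.
by have := ja (n - k)%N; rewrite /v subnK//; apply; rewrite /= leq_subRL// addnC.
Qed.

End IntegralLsc.
Theorem theorem3p4 (R : realType) (d d0 : nat) (S : set 'rV[R]_d)
    (S_nonempty : S !=set0) (S_closed : closed S)
    (N : norm_on ('rV[R]_d * R)%type) (zctr : S * R)
    (eps : R) (eps_ge0 : 0 <= eps)
    (F : set (aw_space N zctr))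
    (F_nonempty : F !=set0) (F_closed : closed F) (F_bounded : aw_bounded F)
    (disp : measure_display) (S0 : measurableType disp)
    (S0_incl : S0 -> 'rV[R]_d0) (S0_incl_inj : injective S0_incl)
    (P0 : probability S0 R) (P0_complete : measure_is_complete P0)
    (psi : S0 -> aw_space N zctr -> \bar R)
    (psi_lsc : random_lsc F psi)
    (psi_inf : locally_inf_integrable P0 F psi)
    (pen : aw_space N zctr -> \bar R)
    (pen_gtNy : forall f, F f -> (-oo < pen f)%E)
    (pen_lsc : lsc_on F pen) :
  let phi f := (integral_pinfty P0 (fun x => psi x f) + pen f)%dE in
  eps_argmin F phi eps !=set0 /\
  (-oo < ereal_inf [set phi f | f in F])%E.
Proof.
move=> phi.
have F_compact := aw_bounded_closed_compact S_closed F_closed F_bounded.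
have I_gtNy f : F f -> (-oo < integral_pinfty P0 (psi^~ f))%E.
  move=> Ff.
  (* The constant sequence at [f] serves to extract the first conclusion. *)
  by have [] := integral_pinfty_lsc F_closed psi_lsc psi_inf (fun=> Ff) Ff (cvg_cst f).
(* With both summands above [-oo], the two conventions for addition agree. *)
have phiE f : F f -> phi f = (integral_pinfty P0 (psi^~ f) + pen f)%E.
  by move=> Ff; rewrite /phi dual_addeE ?I_gtNy ?pen_gtNy.
have [u f Fu Ff uf a|f Ff fmin] := compact_seq_lsc_min F_compact F_nonempty (phi := phi).
  rewrite phiE// => af.
  have [_ Ilsc] := integral_pinfty_lsc F_closed psi_lsc psi_inf Fu Ff uf.
  have plsc b : (b < pen f)%E -> \forall n \near \oo, (b < pen (u n))%E.
    by move=> /lt_le_trans /(_ (pen_lsc _ _ Fu Ff uf)); exact: limn_einf_gt_near.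
  apply: filterS (near_gt_add (I_gtNy _ Ff) (pen_gtNy _ Ff) Ilsc plsc af) => n.
  by rewrite phiE.
have fNy : (-oo < phi f)%E.
  by rewrite phiE// ltNye adde_eq_ninfty negb_or -!ltNye I_gtNy ?pen_gtNy.
have f_inf : (phi f <= ereal_inf [set phi f | f in F])%E.
  by apply: le_ereal_inf_tmp => _ [g Fg <-]; exact: fmin.
split; last exact: lt_le_trans f_inf.
exists f; split=> //; apply: le_trans f_inf _.
by rewrite leeDl// lee_fin.
Qed.
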